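(* Let $i,k,r,s\ge 1$ be integers with $k\ge 2$ and $k\ge i$, and let $n\ge -1$ be an integer. Then $$A_kQ_k^{\,n+1}=\begin{bmatrix} F^{i}_{r,s}(k,n+2k-2) & \ldots & F^{i}_{r,s}(k,n+k-1)\\ F^{i}_{r,s}(k,n+2k-3) & \ldots & F^{i}_{r,s}(k,n+k-2)\\ \vdots & \ddots & \vdots\\ F^{i}_{r,s}(k,n+k) & \ldots & F^{i}_{r,s}(k,n+1)\\ F^{i}_{r,s}(k,n+k-1) & \ldots & F^{i}_{r,s}(k,n) \end{bmatrix},$$ that is, for $1\le a,b\le k$ the $(a,b)$ entry of $A_kQ_k^{\,n+1}$ is $F^{i}_{r,s}(k,n+2k-a-b)$.
   Context: For integers $i,k,r,s\ge 1$, the sequence $F^{i}_{r,s}(k,n)$, $n\ge -1$, is defined as follows. If $i\le k$, then $F^{i}_{r,s}(k,n)=r^{\lfloor (n+1)/i\rfloor}$ for $n=-1,0,\ldots,k-2$; if $k<i$, then $F^{i}_{r,s}(k,n)=s^{\lfloor (n+1)/k\rfloor}$ for $n=-1,0,\ldots,i-2$; and for all $n\ge \max\{k,i\}-1$, $F^{i}_{r,s}(k,n)=rF^{i}_{r,s}(k,n-i)+sF^{i}_{r,s}(k,n-k)$. For $k\ge i$, $Q_k=[q_{tj}]$ is the $k\times k$ matrix in which, for $1\le t\le k$, $q_{t1}$ is the coefficient of $F^{i}_{r,s}(k,n-t)$ in the recurrence $F^{i}_{r,s}(k,n)=rF^{i}_{r,s}(k,n-i)+sF^{i}_{r,s}(k,n-k)$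 (so if $i<k$ then $q_{i1}=r$, $q_{k1}=s$ and $q_{t1}=0$ otherwise; if $i=k$ then $q_{k1}=r+s$ and $q_{t1}=0$ otherwise), and for $j\ge 2$, $q_{tj}=1$ if $j=t+1$ and $q_{tj}=0$ otherwise. $A_k$ is the $k\times k$ matrix whose $(a,b)$ entry, $1\le a,b\le k$, is $F^{i}_{r,s}(k,2k-1-a-b)$ (so its top-left entry is $F^{i}_{r,s}(k,2k-3)$ and its bottom-right entry is $F^{i}_{r,s}(k,-1)$). *)

(* Defs.v *)
From mathcomp Require Import all_boot all_order all_algebra.
From mathcomp Require Import zify.

Set Implicit Arguments.
Unset Strict Implicit.
Unset Printing Implicit Defensive.

Import Order.TTheory GRing.Theory Num.Theory.

Local Open Scope ring_scope.

(* The index is shifted: the argument m stands for F(k, m - 1).  The first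
   argument bounds the recursion depth; since i, k >= 1, depth m is enough
   to compute the value at m. *)
Fixpoint Fshift_rec (i k : nat) (r s : int) (depth m : nat) : int :=
  if (m < maxn i k)%N then
    (if (i <= k)%N then r ^+ (m %/ i)%N else s ^+ (m %/ k)%N)
  else if depth is d.+1 then
    r * Fshift_rec i k r s d (m - i)%N + s * Fshift_rec i k r s d (m - k)%N
  else 0.

(* F^i_{r,s}(k, n) for n >= -1, with junk value 0 for n < -1.  It is
   determined by F_init_le, F_init_gt and F_recurrence below. *)
Definition F (i k : nat) (r s : int) (n : int) : int :=
  if n + 1 is Posz m then Fshift_rec i k r s m m else 0.

Lemma Fshift_rec_depth (i k : nat) (r s : int) (d m : nat) :
  (0 < i)%N -> (0 < k)%N -> (m <= d)%N ->
  Fshift_rec i k r s d m = Fshift_rec i k r s m m.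
Proof.
move=> i0 k0; elim/ltn_ind: m d => m IH [|d] lemd.
  by have -> : m = 0%N by lia.
case: m IH lemd => [|m] IH lemd /=; first by rewrite leq_max i0.
case: ifP => // _.
by rewrite !(IH (m.+1 - i)%N) ?(IH (m.+1 - k)%N) //; lia.
Qed.

Lemma F_init_le (i k : nat) (r s n : int) :
  (1 <= i)%N -> (i <= k)%N -> -1 <= n <= k%:Z - 2 ->
  F i k r s n = r ^+ absz ((n + 1) %/ i%:Z)%Z.
Proof.
move=> i1 ik hn; rewrite /F.
have [m hm] : exists m : nat, n + 1 = m%:Z by exists (absz (n + 1)); lia.
rewrite hm divz_nat absz_nat.
have mk : (m < maxn i k)%N by lia.
by case: m mk {hm} => [|m] mk /=; rewrite mk ik.
Qed.

Lemma F_init_gt (i k : nat) (r s n : int) :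
  (1 <= k)%N -> (k < i)%N -> -1 <= n <= i%:Z - 2 ->
  F i k r s n = s ^+ absz ((n + 1) %/ k%:Z)%Z.
Proof.
move=> k1 ki hn; rewrite /F.
have [m hm] : exists m : nat, n + 1 = m%:Z by exists (absz (n + 1)); lia.
rewrite hm divz_nat absz_nat.
have mk : (m < maxn i k)%N by lia.
have ik : (i <= k)%N = false by lia.
by case: m mk {hm} => [|m] mk /=; rewrite mk ik.
Qed.

Lemma F_recurrence (i k : nat) (r s n : int) :
  (1 <= i)%N -> (1 <= k)%N -> (maxn i k)%:Z - 1 <= n ->
  F i k r s n = r * F i k r s (n - i%:Z) + s * F i k r s (n - k%:Z).
Proof.
move=> i1 k1 hn; rewrite /F.
have [m hm] : exists m : nat, n + 1 = m.+1%:Z by exists (absz n); lia.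
have -> : n - i%:Z + 1 = (m.+1 - i)%N%:Z by lia.
have -> : n - k%:Z + 1 = (m.+1 - k)%N%:Z by lia.
rewrite hm /=.
have -> : (m.+1 < maxn i k)%N = false by lia.
by rewrite (@Fshift_rec_depth i k r s m (m.+1 - i)%N)
  ?(@Fshift_rec_depth i k r s m (m.+1 - k)%N) //; lia.
Qed.

(* Ordinals are 0-based, so the 1-based indices (t, j) are (t.+1, j.+1).  In the
   first column the two terms add up to r + s in row k when i = k. *)
Definition Qmx (i k : nat) (r s : int) : 'M[int]_k :=
  \matrix_(t < k, j < k)
    if (j.+1 == 1)%N then r *+ (t.+1 == i) + s *+ (t.+1 == k)
    else (j.+1 == t.+1 + 1)%N%:R.

Definition Amx (i k : nat) (r s : int) : 'M[int]_k :=
  \matrix_(a < k, b < k)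
    F i k r s (2 * k%:Z - 1 - a.+1%:Z - b.+1%:Z).

(* Main.v *)
(* Multiplying the matrix for n - 1 by Q_k on the right moves column j to column
   j + 1 and puts r F(m - i) + s F(m - k) in row a of the first column, where
   m = n + 2k - a - 1.  As n >= 0 and a <= k, we have m >= k - 1, so the
   recurrence applies and this sum is F(m). *)
Require Import Defs.
From mathcomp Require Import all_boot all_order all_algebra.
From mathcomp Require Import zify.

Set Implicit Arguments.
Unset Strict Implicit.
Unset Printing Implicit Defensive.

Import Order.TTheory GRing.Theory Num.Theory.

Local Open Scope ring_scope.

(** The entries of [Qmx] are built from multiples by booleans, each true in a single row of its
    column, so sums in a product with it collapse. *)
Lemma sum_ord_mulrb_pred1 (V : nmodType) (k : nat) (f : 'I_k -> V)
    (P : pred 'I_k) (t0 : 'I_k) :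
  P =1 pred1 t0 -> \sum_(t < k) f t *+ P t = f t0.
Proof.
move=> PE; under eq_bigr => t _ do rewrite mulrb.
by rewrite -big_mkcond (big_pred1 t0).
Qed.

Lemma mulmx_Qmx (i k : nat) (r s : int) (m : nat) :
  (1 <= i)%N -> (i <= k)%N ->
  (\matrix_(a < k, b < k) F i k r s (m%:Z - 1 + 2 * k%:Z - a.+1%:Z - b.+1%:Z))
    *m Qmx i k r s =
  \matrix_(a < k, b < k) F i k r s (m%:Z + 2 * k%:Z - a.+1%:Z - b.+1%:Z).
Proof.
move=> i1 ik; apply/matrixP => a [[|j] jk]; rewrite !mxE /=.
(* The terms r and s of the first column sit in the 0-based rows [i.-1] and [k.-1]; summing them
   separately also covers i = k. *)
- have i'k : (i.-1 < k)%N by lia.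
  have k'k : (k.-1 < k)%N by lia.
  have ak := ltn_ord a.
  under eq_bigr => t _ do rewrite !mxE /= mulrDr !mulrnAr.
  rewrite big_split /=.
  rewrite (@sum_ord_mulrb_pred1 _ _ _ _ (Ordinal i'k)); last first.
    by move=> t; rewrite /= -val_eqE /=; lia.
  rewrite (@sum_ord_mulrb_pred1 _ _ _ _ (Ordinal k'k)); last first.
    by move=> t; rewrite /= -val_eqE /=; lia.
  rewrite [RHS]F_recurrence //=; try lia.
  by rewrite ![_ * F _ _ _ _ _]mulrC; congr (F _ _ _ _ _ * _ + F _ _ _ _ _ * _); lia.
(* The 0-based column is [j.+1], so its only 1 is in row [j], just above the diagonal. *)
- have jk' : (j < k)%N by lia.
  under eq_bigr => t _ do rewrite !mxE /= mulr_natr.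
  rewrite (@sum_ord_mulrb_pred1 _ _ _ _ (Ordinal jk')) /=; last first.
    by move=> t; rewrite /= -val_eqE /=; lia.
  by congr (F _ _ _ _ _); lia.
Qed.

Theorem theorem5p1 (i k : nat) (r s n : int)
    (hi : (1 <= i)%N) (hk : (2 <= k)%N) (hik : (i <= k)%N)
    (hr : 1 <= r) (hs : 1 <= s) (hn : -1 <= n) :
  Amx i k r s *m Qmx i k r s ^+ absz (n + 1) =
  \matrix_(a < k, b < k) F i k r s (n + 2 * k%:Z - a.+1%:Z - b.+1%:Z).
Proof.
(* With n = m - 1 the exponent is m, and the induction starts at n = -1, where the claim is the
   definition of A_k. *)
have [m ->] : exists m : nat, n = m%:Z - 1 by exists (absz (n + 1)); lia.
rewrite subrK absz_nat {n hn}; elim: m => [|m IH].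
  rewrite expr0 mulmx1; apply/matrixP => a b; rewrite !mxE.
  by congr (F _ _ _ _ _); lia.
rewrite exprSr mulmxA IH mulmx_Qmx //; apply/matrixP => a b; rewrite !mxE.
by congr (F _ _ _ _ _); lia.
Qed.
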